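(* Let $\ast$ and $\vartriangle$ be two arbitrary binary operations on $[0,1]$. The convolution $\ast_\vartriangle$ is a t-norm on $(\mathbf{L},\sqsubseteq)$ if and only if all the following conditions hold: (i) $\ast$ is a continuous t-norm (on $[0,1]$); (ii) if $\ast\neq\wedge$, then $\vartriangle$ is a left-continuous t-norm (on $[0,1]$); (iii) if $\ast=\wedge$, then $\vartriangle$ is a border continuous t-norm (on $[0,1]$).
   Context: $\mathbf{M}$ is the set of all functions $[0,1]\to[0,1]$; $\wedge$ denotes minimum. For binary operations $\ast,\vartriangle$ on $[0,1]$, the convolution $\ast_\vartriangle:\mathbf{M}^2\to\mathbf{M}$ is $(f\ast_\vartriangle g)(x)=\sup\{f(y)\vartriangle g(z)\mid y,z\in[0,1],\ y\ast z=x\}$, with $\sup\varnothing=0$. The relation $\sqsubseteq$ is: $f\sqsubseteq g$ iff $f\wedge_\wedge g=f$ (where $\wedge_\wedge$ is the convolution with $\ast=\vartriangle=\wedge$). $f\in\mathbf{M}$ is normal if $\sup_{x}f(x)=1$, and convex if $x\le y\le z$ implies $f(x)\wedge f(z)\le f(y)$. $\mathbf{L}$ is the set of all normal convex elements of $\mathbf{M}$; $(\mathbf{L},\sqsubseteq)$ is a bounded poset with least element $\bar 0$ and greatest element $\bar 1$, where $\bar a$ is the characteristic function of $\{a\}$. A t-norm on a bounded poset $(P,\le,0_P,1_P)$ is a binary operation $P^2\to P$ that is associative, commutative, monotone increasing in each argument, and has unit $1_P$. ''$\ast_\vartriangle$ is a t-norm on $(\mathbf{L},\sqsubseteq)$''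 means that $\ast_\vartriangle$ maps $\mathbf{L}^2$ into $\mathbf{L}$ and its restriction is a t-norm. A t-norm on $[0,1]$ is called continuous if it is continuous as a function of two variables; border continuous if it is continuous on the boundary $[0,1]^2\setminus(0,1)^2$ of the unit square; left-continuous if it is left-continuous in each argument. *)

(* Defs.v *)
From HB Require Import structures.
From mathcomp Require Import all_boot all_order all_algebra.
From mathcomp Require Import boolp classical_sets set_interval reals topology normedtype.
Set Implicit Arguments.
Unset Strict Implicit.
Unset Printing Implicit Defensive.
Import Order.TTheory GRing.Theory Num.Theory numFieldNormedType.Exports.
Local Open Scope classical_set_scope.
Local Open Scope order_scope.

(* The unit interval, with the order and the topology induced by R. *)
Definition I01 (R : realType) : Type := set_type (`[0%R, 1%R]%classic : set R).
HB.instance Definition _ (R : realType) := SubType.on (I01 R).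
HB.instance Definition _ (R : realType) := Choice.on (I01 R).
HB.instance Definition _ (R : realType) := PseudoMetric.on (I01 R).
HB.instance Definition _ (R : realType) :=
  [SubChoice_isSubOrder of I01 R by <: with ring_display].

Section unit_interval.
Variable R : realType.

Fact I01_0_subproof : (0%R : R) \in (`[0%R, 1%R]%classic : set R).
Proof. by apply/mem_set; rewrite /= in_itv /= lexx ler01. Qed.

Fact I01_1_subproof : (1%R : R) \in (`[0%R, 1%R]%classic : set R).
Proof. by apply/mem_set; rewrite /= in_itv /= lexx ler01. Qed.

Definition zero01 : I01 R := exist _ 0%R I01_0_subproof.
Definition one01 : I01 R := exist _ 1%R I01_1_subproof.

Lemma zero01_le (x : I01 R) : zero01 <= x.
Proof. by rewrite leEsub; have /set_mem := valP x; rewrite /= in_itv => /andP[]. Qed.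

Lemma one01_ge (x : I01 R) : x <= one01.
Proof. by rewrite leEsub; have /set_mem := valP x; rewrite /= in_itv => /andP[]. Qed.

HB.instance Definition _ := Order.hasBottom.Build ring_display (I01 R) zero01_le.
HB.instance Definition _ := Order.hasTop.Build ring_display (I01 R) one01_ge.

End unit_interval.

(* [supremum \bot A] is the least upper bound of [A] in the unit interval, with
   value [\bot] (that is, 0) on the empty set. *)
Definition sup01 (R : realType) (A : set (I01 R)) : I01 R := supremum \bot A.

Lemma ge_sup01 (R : realType) (A : set (I01 R)) (u : I01 R) :
  (sup01 A <= u) <-> (forall a, A a -> a <= u).
Proof.
rewrite /sup01; have [->|A0] := eqVneq A set0.
  by rewrite supremum0; split=> // _; exact: le0x.
have /set0P[a0 Aa0] := A0.
have hs : has_sup [set val a | a in A].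
  split; first by exists (val a0), a0.
  by exists 1%R => _ [a _ <-]; exact: (one01_ge a).
have s01 : sup [set val a | a in A] \in (`[0%R, 1%R]%classic : set R).
  apply/mem_set; rewrite /= in_itv /=; apply/andP; split.
    have a0ge : (0 : R)%R <= val a0 := zero01_le a0.
    apply: (le_trans a0ge); apply: sup_upper_bound => //.
    by exists a0.
  apply: ge_sup; first by exists (val a0), a0.
  by move=> _ [a _ <-]; exact: (one01_ge a).
have hS : supremums A (Sub (sup [set val a | a in A]) s01 : I01 R).
  split=> [a Aa|v Av].
    by rewrite leEsub /=; apply: sup_upper_bound => //; exists a.
  rewrite leEsub /=; apply: ge_sup; first by exists (val a0), a0.
  by move=> _ [a Aa <-]; have := Av _ Aa; rewrite leEsub.
rewrite /supremum (negbTE A0).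
have [hu hl] : supremums A (xget \bot (supremums A)) by apply: (xgetPex _ (ex_intro _ _ hS)).
by split=> [h a Aa|h]; [exact: le_trans (hu _ Aa) h | exact: hl].
Qed.

Definition M (R : realType) : Type := I01 R -> I01 R.

Definition conv (R : realType) (ast tri : I01 R -> I01 R -> I01 R)
    (f g : M R) : M R :=
  fun x => sup01 [set w | exists y z, ast y z = x /\ tri (f y) (g z) = w].

Definition sqle (R : realType) (f g : M R) : Prop := conv Order.min Order.min f g = f.

Definition is_normal (R : realType) (f : M R) : Prop := sup01 (range f) = \top.

Definition is_convex (R : realType) (f : M R) : Prop :=
  forall x y z, x <= y -> y <= z -> Order.min (f x) (f z) <= f y.

Definition char01 (R : realType) (a : I01 R) : M R :=
  fun x => if x == a then \top else \bot.

Definition L (R : realType) : Type :=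
  {f : M R | `[< is_normal f /\ is_convex f >]}.
HB.instance Definition _ (R : realType) := SubType.on (L R).
HB.instance Definition _ (R : realType) := Choice.on (L R).

Section L_poset.
Variable R : realType.
Implicit Types (f g h : M R) (x y z u : I01 R).
Local Notation meetM := (@conv R Order.min Order.min).

Let min0x x : Order.min \bot x = \bot. Proof. exact: min_l (le0x x). Qed.
Let minx0 x : Order.min x \bot = \bot. Proof. exact: min_r (le0x x). Qed.
Let min1x x : Order.min \top x = x. Proof. exact: min_r (lex1 x). Qed.
Let minx1 x : Order.min x \top = x. Proof. exact: min_l (lex1 x). Qed.

Let ge_conv f g x u :
  (meetM f g x <= u) <->
  (forall y z, Order.min y z = x -> Order.min (f y) (g z) <= u).
Proof.
rewrite ge_sup01; split=> [h y z e|h _ [y [z [e <-]]]]; last exact: h.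
by apply: h; exists y, z.
Qed.

Let eq_ge x y : (forall u, x <= u <-> y <= u) -> x = y.
Proof.
by move=> h; apply/le_anti/andP; split; [apply/h | apply/h].
Qed.

Lemma meetMC f g : meetM f g = meetM g f.
Proof.
apply/funext => x; apply: eq_ge => u.
by rewrite !ge_conv; split=> h y z e; rewrite minC; apply: h; rewrite minC.
Qed.

Let ge_min_conv f g h y z u :
  (Order.min (meetM f g y) (h z) <= u) <->
  (forall a b, Order.min a b = y -> Order.min (Order.min (f a) (g b)) (h z) <= u).
Proof.
split=> [H a b e|H].
  have fg := (ge_conv f g y _).1 (lexx _) a b e.
  by apply: le_trans H; rewrite le_min !(ge_min (h z)) lexx orbT andbT ge_min fg.
have [hz|hz] := leP (h z) u; first by rewrite ge_min hz orbT.
rewrite ge_min; apply/orP; left; apply/ge_conv => a b e.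
by move: (H a b e); rewrite ge_min [X in _ || X]leNgt hz orbF.
Qed.

Lemma meetMA f g h : meetM f (meetM g h) = meetM (meetM f g) h.
Proof.
apply/funext => x; apply: eq_ge => u; rewrite !ge_conv.
split=> H y z e.
  apply/ge_min_conv => a b e'; rewrite -minA.
  have /H : Order.min a (Order.min b z) = x by rewrite minA e'.
  by rewrite [X in X <= _ -> _]minC => /ge_min_conv/(_ b z erefl); rewrite minC.
rewrite minC; apply/ge_min_conv => a b e'; rewrite minC minA.
have /H : Order.min (Order.min y a) b = x by rewrite -minA e'.
by move=> /ge_min_conv/(_ y a erefl).
Qed.

Lemma L_normal (f : L R) : is_normal (val f).
Proof. by case: f => f /= /asboolP[]. Qed.

Lemma L_convex (f : L R) : is_convex (val f).
Proof. by case: f => f /= /asboolP[]. Qed.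

Definition L_le (f g : L R) : bool := `[< sqle (val f) (val g) >].

Fact L_le_refl : reflexive L_le.
Proof.
move=> f; apply/asboolP/funext => x; apply: eq_ge => u; rewrite ge_conv.
split=> [/(_ x x (minxx _))|H y z e]; first by rewrite minxx.
apply: le_trans H; case: (leP y z) e => [_ <-|_ <-]; rewrite ge_min lexx ?orbT //.
Qed.

Fact L_le_anti : antisymmetric L_le.
Proof.
by move=> f g /andP[/asboolP fg /asboolP gf]; apply: val_inj; rewrite -fg meetMC.
Qed.

Fact L_le_trans : transitive L_le.
Proof.
move=> g f h /asboolP fg /asboolP gh; apply/asboolP.
by rewrite /sqle -{1}fg -meetMA gh fg.
Qed.

Fact L_display : Order.disp_t. Proof. exact: Order.Disp tt tt. Qed.

HB.instance Definition _ :=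
  Order.Le_isPOrder.Build L_display (L R) L_le_refl L_le_anti L_le_trans.

Fact char01_L (a : I01 R) : `[< is_normal (char01 a) /\ is_convex (char01 a) >].
Proof.
apply/asboolP; split.
  apply/le_anti; rewrite lex1 /=.
  have : sup01 (range (char01 a)) <= sup01 (range (char01 a)) by [].
  by rewrite ge_sup01; apply; exists a => //; rewrite /char01 eqxx.
move=> x y z xy yz; rewrite /char01.
have [xa|_] := eqVneq x a; last by rewrite min0x le0x.
have [za|_] := eqVneq z a; last by rewrite minx0 le0x.
have -> : y = a by apply/le_anti; rewrite -{1}za yz -xa xy.
by rewrite eqxx lex1.
Qed.

Definition charL (a : I01 R) : L R := exist _ (char01 a) (char01_L a).

Fact charL_bot (f : L R) : charL \bot <= f.
Proof.
apply/asboolP/funext => x; apply: eq_ge => u; rewrite ge_conv /= /char01.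
split=> [H|H y z e].
  have [x0|_] := eqVneq x \bot; last exact: le0x.
  rewrite -(L_normal f) ge_sup01 => _ [z _ <-].
  by have := H \bot z; rewrite x0 min0x eqxx min1x; apply.
have [y0|_] := eqVneq y \bot; last by rewrite min0x le0x.
move: H; rewrite -e y0 min0x eqxx => H; exact: le_trans (lex1 _) H.
Qed.

Fact charL_top (f : L R) : f <= charL \top.
Proof.
apply/asboolP/funext => x; apply: eq_ge => u; rewrite ge_conv /= /char01.
split=> [/(_ x \top)|H y z e].
  by rewrite eqxx !minx1; apply.
have [z1|_] := eqVneq z \top; last by rewrite minx0 le0x.
by move: H; rewrite -e z1 !minx1.
Qed.

HB.instance Definition _ := Order.hasBottom.Build L_display (L R) charL_bot.
HB.instance Definition _ := Order.hasTop.Build L_display (L R) charL_top.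

End L_poset.

Definition is_tnorm d (P : tbPOrderType d) (T : P -> P -> P) : Prop :=
  [/\ associative T,
      commutative T,
      (forall x y z, y <= z -> T x y <= T x z),
      (forall x y z, x <= y -> T x z <= T y z)
    & (forall x, T x \top = x)].

(* The first component is the closure of L under the convolution; [T] is then
   its restriction to L. *)
Definition conv_tnorm_on_L (R : realType) (ast tri : I01 R -> I01 R -> I01 R) : Prop :=
  exists T : L R -> L R -> L R,
    (forall f g : L R, val (T f g) = conv ast tri (val f) (val g)) /\ is_tnorm T.

Definition continuous_op (R : realType) (T : I01 R -> I01 R -> I01 R) : Prop :=
  continuous (fun p : I01 R * I01 R => T p.1 p.2).

(* Continuity as a function on the whole square, at each point of the boundary:
   the mere restriction of a t-norm to the boundary is always continuous. *)
Definition border_continuous_op (R : realType) (T : I01 R -> I01 R -> I01 R) : Prop :=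
  forall p : I01 R * I01 R,
    ~ (\bot < p.1 < \top /\ \bot < p.2 < \top) ->
    {for p, continuous (fun p : I01 R * I01 R => T p.1 p.2)}.

Definition left_continuous (R : realType) (h : I01 R -> I01 R) : Prop :=
  forall a : I01 R, h x @[x --> within (fun x => x < a) (nbhs a)] --> h a.

Definition left_continuous_op (R : realType) (T : I01 R -> I01 R -> I01 R) : Prop :=
  (forall y, left_continuous (T^~ y)) /\ (forall x, left_continuous (T x)).

(* Main.v *)
Require Import Defs.
From mathcomp Require Import all_boot all_order all_algebra.
From mathcomp Require Import boolp classical_sets reals topology.
From mathcomp Require Import normedtype lra.

(* On normal convex functions, [f] is below [g] iff [f x <= sup_(y >= x) g y]
   and [g x <= sup_(y <= x) f y] for all [x], and each of these one-sided
   suprema is either [1] or attained at [x]. A border continuous t-norm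
   therefore commutes with them, which gives monotonicity of the convolution;
   its convexity follows from the intermediate value property of [ast] along
   paths towards an almost-mode. Only associativity needs more: left continuity
   of [tri], or [ast = min], for which the convolution is a maximum of two
   terms built from one-sided suprema.

   Conversely, characteristic functions of points embed ([0,1], [ast]) into L,
   values at [1] recover [tri], and convexity of the convolution of the constant
   [1] with a point gives the intermediate value property, hence the continuity,
   of [ast]. Monotonicity, tested on a function with an unattained supremum,
   gives the border continuity of [tri]. If [ast <> min], some level curve
   [y * z = x] has a corner where [y] and [z] both vary strictly, which lets the
   convolution take an arbitrary value [a] as an unattained supremum;
   associativity then forces left continuity. *)

Set Implicit Arguments.
Unset Strict Implicit.
Unset Printing Implicit Defensive.
Import Order.TTheory GRing.Theory Num.Theory numFieldNormedType.Exports.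
Local Open Scope classical_set_scope.
Local Open Scope order_scope.

(** * Points, order and suprema of the unit interval *)

Section unit_interval.
Variable R : realType.
Implicit Types (a b c u v x y z : I01 R) (A : set (I01 R)).

Let bot_ltE x : (\bot < x) = (0 < val x)%R. Proof. by []. Qed.
Let lt_topE x : (x < \top) = (val x < 1)%R. Proof. by []. Qed.

Let val01 x : (0 <= val x <= 1)%R.
Proof. by apply/andP; split; [exact: zero01_le | exact: one01_ge]. Qed.

Fact clamp01_subproof (r : R) :
  Order.max 0%R (Order.min 1%R r) \in (`[0%R, 1%R]%classic : set R).
Proof.
apply/mem_set; rewrite /= in_itv /= le_max lexx /=.
by rewrite ge_max ler01 ge_min lexx.
Qed.

Definition clamp01 (r : R) : I01 R :=
  exist (fun s => s \in (`[0%R, 1%R]%classic : set R)) _ (clamp01_subproof r).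

Lemma val_clamp01 (r : R) : (0 <= r <= 1)%R -> val (clamp01 r) = r.
Proof. by move=> /andP[r0 r1]; rewrite /= (min_r r1) (max_r r0). Qed.

Lemma clamp01_lt (r : R) x : (0 < val x)%R -> (r < val x)%R -> clamp01 r < x.
Proof. by move=> x0 rx; rewrite ltEsub /= gt_max x0 gt_min rx orbT. Qed.

Lemma lt_clamp01 (r : R) x : (val x < 1)%R -> (val x < r)%R -> x < clamp01 r.
Proof. by move=> x1 xr; rewrite ltEsub /= lt_max lt_min x1 xr orbT. Qed.

Lemma clamp01_le (r : R) : (0 <= r)%R -> (val (clamp01 r) <= r)%R.
Proof. by move=> r0; rewrite /= ge_max r0 ge_min lexx orbT. Qed.

Lemma clamp01_ge (r : R) : (r <= 1)%R -> (r <= val (clamp01 r))%R.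
Proof. by move=> r1; rewrite /= le_max le_min r1 lexx orbT. Qed.

Lemma le_clamp01 (r s : R) : (r <= s)%R -> clamp01 r <= clamp01 s.
Proof. by move=> rs; rewrite leEsub /= le_max2 // le_min2. Qed.

Lemma I01_dense x y : x < y -> exists z, x < z < y.
Proof.
rewrite ltEsub => xy; have /andP[x0 x1] := val01 x; have /andP[y0 y1] := val01 y.
exists (clamp01 ((val x + val y) / 2)%R).
by rewrite lt_clamp01 ?clamp01_lt //; lra.
Qed.

Lemma bot_lt_top : (\bot : I01 R) < \top.
Proof. by rewrite bot_ltE ltr01. Qed.

(** The clamped line [a - (y - c)] tends to [a] as [y] decreases to [c] without reaching it; it
    yields the unattained suprema of the test functions below. *)
Lemma exists_ramp c a : c < \top -> \bot < a ->
  exists r : I01 R -> I01 R, [/\ forall x y, x <= y -> r y <= r x,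
    forall y, c < y -> r y < a
  & forall u, u < a -> exists2 y, c < y & u < r y].
Proof.
rewrite lt_topE bot_ltE => c1 a0.
have /andP[c0 _] := val01 c; have /andP[_ a1] := val01 a.
exists (fun y => clamp01 (val a - (val y - val c))%R); split=> [x y|y|u].
- by rewrite leEsub => xy; apply: le_clamp01; lra.
- by rewrite ltEsub => cy; apply: clamp01_lt => //; lra.
rewrite ltEsub => ua; have /andP[u0 u1] := val01 u.
exists (clamp01 (val c + (val a - val u) / 2)%R); first by apply: lt_clamp01; lra.
apply: lt_clamp01; first lra.
have : (0 <= val c + (val a - val u) / 2)%R by lra.
by move=> /clamp01_le; lra.
Qed.

Lemma sup01_ub A a : A a -> a <= sup01 A.
Proof. by move=> Aa; have [h _] := ge_sup01 A (sup01 A); exact: h (lexx _) _ Aa. Qed.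

Lemma lt_sup01 A u : u < sup01 A -> exists2 a, A a & u < a.
Proof.
move=> uA; apply: contrapT => h; move: uA; rewrite ltNge => /negP; apply.
apply/ge_sup01 => a Aa; rewrite leNgt; apply/negP => ua; apply: h; by exists a.
Qed.

(** * Topology of the unit interval *)

Let ball01 a (e : R) x : (`|val a - val x| < e)%R -> ball a e x.
Proof. by []. Qed.

Let ball01W a (e : R) x : ball a e x -> (`|val a - val x| < e)%R.
Proof. by []. Qed.

Lemma near_gt_I01 a u : u < a -> \forall x \near a, u < x.
Proof.
rewrite ltEsub => ua; apply/nbhs_ballP; exists (val a - val u)%R => [|x].
  by rewrite /= subr_gt0.
by move=> /ball01W; rewrite ltEsub ltr_norml; lra.
Qed.

Lemma near_lt_I01 a u : a < u -> \forall x \near a, x < u.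
Proof.
rewrite ltEsub => ua; apply/nbhs_ballP; exists (val u - val a)%R => [|x].
  by rewrite /= subr_gt0.
by move=> /ball01W; rewrite ltEsub ltr_norml; lra.
Qed.

Lemma nbhs_ex_lt a (P : set (I01 R)) :
  \bot < a -> nbhs a P -> exists2 x, x < a & P x.
Proof.
rewrite bot_ltE => a0 /nbhs_ballP[e /= e0 eP]; have /andP[_ a1] := val01 a.
have lt_a : clamp01 (val a - e / 2) < a by apply: clamp01_lt => //; lra.
exists (clamp01 (val a - e / 2)%R) => //; apply/eP/ball01.
have : (val a - e / 2 <= 1)%R by lra.
by move: lt_a => + /clamp01_ge; rewrite ltEsub ltr_norml; lra.
Qed.

Lemma nbhs_ex_gt a (P : set (I01 R)) :
  a < \top -> nbhs a P -> exists2 x, a < x & P x.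
Proof.
rewrite lt_topE => a1 /nbhs_ballP[e /= e0 eP]; have /andP[a0 _] := val01 a.
have lt_a : a < clamp01 (val a + e / 2) by apply: lt_clamp01 => //; lra.
exists (clamp01 (val a + e / 2)%R) => //; apply/eP/ball01.
have : (0 <= val a + e / 2)%R by lra.
by move: lt_a => + /clamp01_le; rewrite ltEsub ltr_norml; lra.
Qed.

Lemma cvg_I01 (T : Type) (F : set_system T) (f : T -> I01 R) l : Filter F ->
  (forall u, u < l -> \forall x \near F, u < f x) ->
  (forall u, l < u -> \forall x \near F, f x < u) -> f @ F --> l.
Proof.
move=> FF lo hi; apply/cvg_ballP => e e0.
have /andP[l0 l1] := val01 l.
have lo' : \forall x \near F, (val l - e < val (f x))%R.
  have [le|le] := ltP (val l - e)%R 0%R.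
    by near=> x; apply: lt_le_trans le _; have /andP[] := val01 (f x).
  apply: filterS (lo (clamp01 (val l - e)) _) => [x|].
    by rewrite ltEsub val_clamp01 //; lra.
  by apply: clamp01_lt; lra.
have hi' : \forall x \near F, (val (f x) < val l + e)%R.
  have [le|le] := ltP 1%R (val l + e)%R.
    by near=> x; apply: le_lt_trans le; have /andP[] := val01 (f x).
  apply: filterS (hi (clamp01 (val l + e)) _) => [x|].
    by rewrite ltEsub val_clamp01 //; lra.
  by apply: lt_clamp01; lra.
apply: filterS2 lo' hi' => x h1 h2.
by apply: ball01; rewrite ltr_norml; lra.
Unshelve. all: by end_near. Qed.

End unit_interval.

(** * Regularity of t-norms on the unit interval *)

Section regularity.
Variables (R : realType) (T : I01 R -> I01 R -> I01 R).

(** For a t-norm, an order form of continuity: the section [T^~ z] increases from [\bot] to [z] and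
    skips no value. *)
Definition divisible_op := forall x z, x <= z -> exists y, T y z = x.

(* For a t-norm, which is monotone, left continuity and continuity at the
   border amount to these two instances of lower semicontinuity. *)
Definition left_lsc :=
  forall a b u, (forall t, t < a -> T t b <= u) -> T a b <= u.

Definition border_lsc :=
  forall b u, (forall t, t < \top -> T t b <= u) -> b <= u.

End regularity.

Section tnorm_theory.
Variables (R : realType) (T : I01 R -> I01 R -> I01 R).
Hypothesis tT : is_tnorm T.
Implicit Types a b c u v w x y z : I01 R.

Lemma tnorm_le2 x x' y y' : x <= x' -> y <= y' -> T x y <= T x' y'.
Proof.
case: tT => _ _ Tr Tl _ xx yy.
exact: le_trans (Tl _ _ _ xx) (Tr _ _ _ yy).
Qed.

Lemma tnormC x y : T x y = T y x. Proof. by case: tT. Qed.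

Lemma tnormA x y z : T x (T y z) = T (T x y) z. Proof. by case: tT. Qed.

Lemma tnormx1 x : T x \top = x. Proof. by case: tT. Qed.

Lemma tnorm1x x : T \top x = x. Proof. by rewrite tnormC tnormx1. Qed.

Lemma tnorm_lel x y : T x y <= x.
Proof. by rewrite -[leRHS]tnormx1; apply: tnorm_le2; rewrite ?lexx ?lex1. Qed.

Lemma tnorm_ler x y : T x y <= y. Proof. by rewrite tnormC tnorm_lel. Qed.

Lemma tnormx0 x : T x \bot = \bot.
Proof. by apply/eqP; rewrite -lex0 tnorm_ler. Qed.

Lemma tnorm0x x : T \bot x = \bot. Proof. by rewrite tnormC tnormx0. Qed.

Lemma tnorm_top x y : T x y = \top -> x = \top /\ y = \top.
Proof.
by move=> e; split; apply/eqP; rewrite -le1x -e ?tnorm_lel ?tnorm_ler.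
Qed.

Lemma continuous_divisible : continuous_op T -> divisible_op T.
Proof.
move=> cT x z xz; pose A := [set y | T y z <= x].
have near_Tz y (P : set (I01 R)) : nbhs (T y z) P -> nbhs y (T^~ z @^-1` P).
  move=> nP; have [[Q Q'] [/= nQ nQ'] QQ'] := cT (y, z) _ nP.
  by apply: filterS nQ => t Qt; exact: QQ' (t, z) (conj Qt (nbhs_singleton nQ')).
exists (sup01 A); apply/le_anti/andP; split; rewrite leNgt; apply/negP => lt_x.
  have A0 : \bot < sup01 A.
    rewrite lt0x; apply/eqP => A0; move: lt_x; rewrite A0 tnorm0x.
    by rewrite ltNge le0x.
  have [y yA xy] := nbhs_ex_lt A0 (near_Tz _ _ (near_gt_I01 lt_x)).
  have [y' Ay' yy'] := lt_sup01 yA.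
  have := le_trans (tnorm_le2 (ltW yy') (lexx z)) Ay'.
  by rewrite leNgt [x < _]xy.
have A1 : sup01 A < \top.
  rewrite ltx1; apply/eqP => A1; move: lt_x; rewrite A1 tnorm1x.
  by rewrite ltNge xz.
have [y Ay yx] := nbhs_ex_gt A1 (near_Tz _ _ (near_lt_I01 lt_x)).
by move: Ay; rewrite ltNge sup01_ub // /A /= ltW.
Qed.

(** A value between [T c b] and [b] is attained, necessarily to the right of [c]. If [T c b = b]
    there is none, but the section is constant from [c] on and [\top] serves. *)
Lemma divisible_lt c b u : divisible_op T -> T c b < u ->
  exists y, (c < y \/ y = \top) /\ T y b < u.
Proof.
move=> dT cu; have [bcb|cb_lt] := leP b (T c b).
  by exists \top; split; [right | rewrite tnorm1x (le_lt_trans bcb)].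
have : T c b < Order.min u b by rewrite lt_min cu.
move=> /I01_dense[w /andP[cw]]; rewrite lt_min => /andP[wu wb].
have [y yb] := dT _ _ (ltW wb); exists y; split; last by rewrite yb.
left; rewrite ltNge; apply/negP => yc; move: cw; rewrite -yb ltNge => /negP; apply.
exact: tnorm_le2.
Qed.

Lemma divisible_gt c b u : divisible_op T -> u < T c b ->
  exists2 y, y < c & u < T y b.
Proof.
move=> dT /I01_dense[w /andP[uw wc]].
have [y yb] := dT _ _ (le_trans (ltW wc) (tnorm_ler _ _)).
exists y; last by rewrite yb.
rewrite ltNge; apply/negP => cy; move: wc; rewrite -yb ltNge => /negP; apply.
exact: tnorm_le2.
Qed.

Lemma divisible_continuous : divisible_op T -> continuous_op T.
Proof.
move=> dT [a b]; apply: cvg_I01 => /= u.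
  move=> /(divisible_gt dT)[a' a'a]; rewrite tnormC => /(divisible_gt dT)[b' b'b].
  rewrite tnormC => uT; exists ([set x | a' < x], [set y | b' < y]) => /=.
    by split; exact: near_gt_I01.
  move=> [x y] [/= a'x b'y]; apply: lt_le_trans uT _.
  by apply: tnorm_le2; exact: ltW.
have near_le (c c' : I01 R) : c < c' \/ c' = \top -> nbhs c [set x | x <= c'].
  move=> [/near_lt_I01|->]; first by apply: filterS => x /ltW.
  by apply: filterS filterT => x _ /=; rewrite lex1.
move=> /(divisible_lt dT)[a' [/near_le aa']]; rewrite tnormC.
move=> /(divisible_lt dT)[b' [/near_le bb']]; rewrite tnormC => Tu.
exists ([set x | x <= a'], [set y | y <= b']) => //= -[x y] [/= xa' yb'].
exact: le_lt_trans (tnorm_le2 xa' yb') Tu.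
Qed.

(** By monotonicity only the lower bound is at stake, and commutativity carries it to the second
    argument. *)
Lemma left_continuous_lscP : left_continuous_op T <-> left_lsc T.
Proof.
have Tl x : {homo T x : y z / y <= z} by move=> y z; exact: tnorm_le2.
have Tr y : {homo T^~ y : x z / x <= z} by move=> x z xz; exact: tnorm_le2.
split=> [[lT _] a b u Tu|lT].
  have [a0|a0] := leP a \bot.
    by move: a0; rewrite lex0 => /eqP ->; rewrite tnorm0x le0x.
  rewrite leNgt; apply/negP => uT.
  have /(_ _ (near_gt_I01 uT)) := lT b a.
  move=> /(nbhs_ex_lt a0)[x xa /(_ xa)] /=.
  by rewrite ltNge Tu.
have lTr y : left_continuous (T^~ y).
  move=> a; apply: cvg_I01 => u /=.
    move=> uT; have [t ta ut] : exists2 t, t < a & u < T t y.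
      apply: contrapT => h; move: uT; rewrite ltNge => /negP; apply.
      apply: lT => t ta; rewrite leNgt; apply/negP => ut; apply: h.
      by exists t.
    apply: filterS (near_gt_I01 ta) => x /= tx _.
    by apply: lt_le_trans ut _; apply: Tr; exact: ltW.
  move=> Tu; apply: (filterS _ (filterT : nbhs a setT)) => x _ xa.
  apply: le_lt_trans Tu.
  by apply: Tr; exact: ltW.
split=> // x; have -> // : T x = T^~ x by apply/funext => y; exact: tnormC.
Qed.

(** The minimum bounds [T] from above and agrees with it on the border, so only lower bounds near a
    point with a coordinate [\top] are at stake. *)
Lemma border_continuous_lscP : border_continuous_op T <-> border_lsc T.
Proof.
split=> [bT b u Tu|bT].
  rewrite leNgt; apply/negP => ub.
  have ub' : u < T \top b by rewrite tnorm1x.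
  have nb :
      ~ (\bot < (\top : I01 R, b).1 < \top /\ \bot < (\top : I01 R, b).2 < \top).
    by move=> [/andP[_]]; rewrite ltxx.
  have [[P Q] [/= nP nQ] PQ] := bT _ nb _ (near_gt_I01 ub').
  have [t t1 Pt] := nbhs_ex_lt (bot_lt_top R) nP.
  have /= := PQ (t, b) (conj Pt (nbhs_singleton nQ)).
  by rewrite ltNge Tu.
have lo a b u : u < T a b -> a = \top \/ b = \top ->
    \forall p \near (a, b), u < T p.1 p.2.
  wlog -> : a b / a = \top => [hw|].
    move=> uT [a1|b1]; first by apply: hw; by [|left].
    have [|||[P Q] [/= nP nQ] PQ] := hw b a; rewrite 1?tnormC; [by []..|by left|].
    exists (Q, P) => //= -[x y] [/= Qx Py].
    by have := PQ (y, x) (conj Py Qx); rewrite tnormC.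
  (* Using [bT] at some [w < b] leaves room in both coordinates; monotonicity covers the box above
     [(t, w)]. *)
  rewrite tnorm1x => /I01_dense[w /andP[uw wb]] _.
  have [t t1 ut] : exists2 t, t < \top & u < T t w.
    apply: contrapT => h; move: uw; rewrite ltNge => /negP; apply.
    apply: bT => t ta; rewrite leNgt; apply/negP => ut; apply: h.
    by exists t.
  exists ([set x | t < x], [set y | w < y]) => /=.
    by split; exact: near_gt_I01.
  move=> [x y] [/= tx wy]; apply: lt_le_trans ut _.
  by apply: tnorm_le2; exact: ltW.
have hi_l a b u : a < u -> \forall p \near (a, b), T p.1 p.2 < u.
  move=> au; exists ([set x | x < u], setT) => /=.
    by split; [exact: near_lt_I01 | exact: filterT].
  by move=> [x y] [/= xu _]; apply: le_lt_trans (tnorm_lel _ _) xu.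
have hi_r a b u : b < u -> \forall p \near (a, b), T p.1 p.2 < u.
  move=> bu; exists (setT, [set y | y < u]) => /=.
    by split; [exact: filterT | exact: near_lt_I01].
  by move=> [x y] [/= _ yu]; apply: le_lt_trans (tnorm_ler _ _) yu.
move=> [a b] /= nb; have [a0|a_gt0] := leP a \bot.
  move: a0; rewrite lex0 => /eqP ->; apply: cvg_I01 => /= u; rewrite tnorm0x.
    by rewrite ltNge le0x.
  exact: hi_l.
have [b0|b_gt0] := leP b \bot.
  move: b0; rewrite lex0 => /eqP ->; apply: cvg_I01 => /= u; rewrite tnormx0.
    by rewrite ltNge le0x.
  exact: hi_r.
have ab : a = \top \/ b = \top.
  have [a1|a_lt1] := leP \top a; first by left; apply/eqP; rewrite -le1x.
  have [b1|b_lt1] := leP \top b; first by right; apply/eqP; rewrite -le1x.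
  by case: nb; rewrite a_gt0 a_lt1 b_gt0.
apply: cvg_I01 => /= u; first by move=> /lo; apply.
case: ab => ->; rewrite ?tnorm1x ?tnormx1; [exact: hi_r | exact: hi_l].
Qed.

End tnorm_theory.

(** * Normal convex functions *)

Section normal_convex.
Variable R : realType.
Implicit Types (f g h : M R) (a b c u v x y z : I01 R).

Definition in_L f := is_normal f /\ is_convex f.

(** The least isotone function above [f]; [rsup] gives the least antitone one. *)
Definition lsup f x : I01 R := sup01 [set f y | y in [set y | y <= x]].
Definition rsup f x : I01 R := sup01 [set f y | y in [set y | x <= y]].

Lemma lsup_ub f x y : y <= x -> f y <= lsup f x.
Proof. by move=> yx; apply: sup01_ub; exists y. Qed.

Lemma rsup_ub f x y : x <= y -> f y <= rsup f x.
Proof. by move=> xy; apply: sup01_ub; exists y. Qed.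

Lemma normal_gt f u : is_normal f -> u < \top -> exists x, u < f x.
Proof. by move=> nf; rewrite -nf => /lt_sup01[_ [x _ <-] ux]; exists x. Qed.

Lemma normalP f : (forall u, u < \top -> exists x, u < f x) -> is_normal f.
Proof.
move=> H; apply/eqP; rewrite -le1x leNgt; apply/negP => /H[x].
by rewrite ltNge sup01_ub //; exists x.
Qed.

Lemma normal_top f x : f x = \top -> is_normal f.
Proof. by move=> fx; apply: normalP => u u1; exists x; rewrite fx. Qed.

Lemma antitone_in_L f : f \bot = \top -> (forall x y, x <= y -> f y <= f x) ->
  in_L f.
Proof.
move=> f0 af; split; first exact: normal_top f0.
by move=> x y z _ yz; rewrite ge_min (af _ _ yz) orbT.
Qed.

Lemma isotone_in_L f : f \top = \top -> (forall x y, x <= y -> f x <= f y) ->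
  in_L f.
Proof.
move=> f1 af; split; first exact: normal_top f1.
by move=> x y z xy _; rewrite ge_min (af _ _ xy).
Qed.

Lemma char01_in_L a : in_L (char01 a).
Proof. exact/asboolP/char01_L. Qed.

Lemma lsup_rsup_top f x : is_normal f -> lsup f x = \top \/ rsup f x = \top.
Proof.
move=> nf; have [l1|] := eqVneq (lsup f x) \top; first by left.
have [r1|] := eqVneq (rsup f x) \top; first by right.
rewrite -!ltx1 => r1 l1.
have : Order.max (lsup f x) (rsup f x) < \top by rewrite gt_max l1.
move=> /(normal_gt nf)[y]; have [yx|/ltW xy] := leP y x.
  by rewrite ltNge le_max lsup_ub.
by rewrite ltNge le_max rsup_ub ?orbT.
Qed.

Lemma min_lsup_rsup f x : is_convex f -> Order.min (lsup f x) (rsup f x) <= f x.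
Proof.
move=> cf; rewrite leNgt; apply/negP; rewrite lt_min => /andP[].
move=> /lt_sup01[_ [y yx <-] fy] /lt_sup01[_ [z xz <-] fz].
by have := cf _ _ _ yx xz; rewrite leNgt lt_min fy fz.
Qed.

(** If the left supremum is below 1, the right one is 1 and convexity puts the left one under [f x].
    So only a supremum equal to 1 can fail to be attained at [x], and border continuity passes it
    through [tri]. *)
Lemma lsup_cases f x : in_L f -> lsup f x = \top \/ lsup f x = f x.
Proof.
move=> [nf cf]; have [|r1] := lsup_rsup_top x nf; first by left.
right; apply/le_anti; rewrite lsup_ub ?lexx // andbT.
by have := min_lsup_rsup x cf; rewrite r1 (min_l (lex1 _)).
Qed.

Lemma rsup_cases f x : in_L f -> rsup f x = \top \/ rsup f x = f x.
Proof.
move=> [nf cf]; have [l1|] := lsup_rsup_top x nf; last by left.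
right; apply/le_anti; rewrite rsup_ub ?lexx // andbT.
by have := min_lsup_rsup x cf; rewrite l1 (min_r (lex1 _)).
Qed.

Lemma convex_between f a b x : is_convex f ->
  Order.min a b <= x -> x <= Order.max a b -> Order.min (f a) (f b) <= f x.
Proof.
move=> cf; case: (leP a b) => ab ax xb; first exact: cf ax xb.
by rewrite minC; exact: cf ax xb.
Qed.

Lemma ge_conv (ast tri : I01 R -> I01 R -> I01 R) f g x u :
  (conv ast tri f g x <= u) <->
  (forall y z, ast y z = x -> tri (f y) (g z) <= u).
Proof.
rewrite ge_sup01; split=> [h y z e|h _ [y [z [e <-]]]]; last exact: h.
by apply: h; exists y, z.
Qed.

Lemma conv_ub (ast tri : I01 R -> I01 R -> I01 R) f g y z :
  tri (f y) (g z) <= conv ast tri f g (ast y z).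
Proof. exact: (ge_conv ast tri f g _ _).1 (lexx _) y z erefl. Qed.

Lemma sqleP f g : in_L f -> in_L g ->
  sqle f g <-> (forall x, f x <= rsup g x) /\ (forall x, g x <= lsup f x).
Proof.
move=> [nf cf] [ng cg]; split=> [fg|[fg gf]].
  split=> x.
    rewrite -[f]fg; apply/ge_conv => y z yz; rewrite ge_min rsup_ub ?orbT //.
    by rewrite -yz ge_min lexx orbT.
  have [->|r1] := lsup_rsup_top x nf; first exact: lex1.
  apply: le_trans (lsup_ub _ (lexx x)); rewrite leNgt; apply/negP => fxg.
  (* Some [y >= x] has [f y > f x], and the pair [(y, x)] pushes the meet at [x] above [f x]. *)
  have : f x < rsup f x by rewrite r1 (lt_le_trans fxg) ?lex1.
  move=> /lt_sup01[_ [y xy <-] fxy].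
  have := conv_ub Order.min Order.min f g y x.
  by rewrite [conv _ _ _ _]fg (min_r xy) leNgt lt_min fxy fxg.
apply/funext => x; apply/le_anti/andP; split.
  apply/ge_conv => y z yz; have [le_yz|lt_zy] := leP y z.
    by rewrite -yz (min_l le_yz) ge_min lexx.
  rewrite -{}yz (min_r (ltW lt_zy)) minC.
  apply: le_trans (min_lsup_rsup z cf).
  by apply: le_min2; [exact: gf | exact: rsup_ub (ltW lt_zy)].
rewrite leNgt; apply/negP => lt_x; have := lt_le_trans lt_x (fg x).
move=> /lt_sup01[_ [z xz <-] gz].
have := conv_ub Order.min Order.min f g x z.
by rewrite (min_l xz) leNgt lt_min lt_x gz.
Qed.

Lemma sqle_char a b : sqle (char01 a) (char01 b) <-> a <= b.
Proof.
have [aL bL] := (char01_in_L a, char01_in_L b); rewrite (sqleP aL bL).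
split=> [[/(_ a) + _]|ab].
  rewrite {1}/char01 eqxx => r1; rewrite leNgt; apply/negP => ba.
  have /lt_sup01[_ [y ay <-]] := lt_le_trans (bot_lt_top R) r1.
  rewrite /char01; have [yb|_] := eqVneq y b; last by rewrite ltxx.
  by move: ay; rewrite /= yb leNgt ba.
have char_at c : char01 c c = \top by rewrite /char01 eqxx.
split=> x; rewrite {1}/char01; case: eqVneq => [->|_]; rewrite ?le0x //.
  by rewrite -(char_at b) rsup_ub.
by rewrite -(char_at a) lsup_ub.
Qed.

(** Replaces the subtype [L] by plain functions; commutativity reduces monotonicity to one
    argument. *)
Lemma conv_tnorm_on_LP (ast tri : I01 R -> I01 R -> I01 R) (C := conv ast tri) :
  conv_tnorm_on_L ast tri <->
  [/\ forall f g, in_L f -> in_L g -> in_L (C f g),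
      forall f g h, in_L f -> in_L g -> in_L h -> C f (C g h) = C (C f g) h,
      forall f g, in_L f -> in_L g -> C f g = C g f,
      forall f g h, in_L f -> in_L g -> in_L h -> sqle g h -> sqle (C f g) (C f h)
    & forall f, in_L f -> C f (char01 \top) = f].
Proof.
have memL (f : L R) : in_L (val f) by split; [exact: L_normal | exact: L_convex].
pose mk f (fL : in_L f) : L R := exist _ f (asboolT fL).
have mkK f (fL : in_L f) : val (mk f fL) = f by [].
split=> [[T [valT [TA TC Tr _ T1]]]|[CL CA CC CM C1]].
  split.
  - move=> f g fL gL; rewrite -(mkK _ fL) -(mkK _ gL) /C -valT; exact: memL.
  - move=> f g h fL gL hL; rewrite -(mkK _ fL) -(mkK _ gL) -(mkK _ hL) /C.
    by rewrite -!valT TA.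
  - by move=> f g fL gL; rewrite -(mkK _ fL) -(mkK _ gL) /C -!valT TC.
  - move=> f g h fL gL hL gh.
    have /asboolP : L_le (T (mk f fL) (mk g gL)) (T (mk f fL) (mk h hL)).
      by apply: Tr; apply/asboolP.
    by rewrite !valT.
  - by move=> f fL; rewrite -{2}(mkK _ fL) -(T1 (mk _ fL)) valT.
pose T (f g : L R) : L R := mk _ (CL _ _ (memL f) (memL g)).
have valT (f g : L R) : val (T f g) = C (val f) (val g) by [].
have TC : commutative T by move=> f g; apply: val_inj; rewrite !valT CC.
have Tr (f g h : L R) : g <= h -> T f g <= T f h.
  by move=> /asboolP gh; apply/asboolP; rewrite !valT; exact: CM.
exists T; split=> //; split=> //.
- by move=> f g h; apply: val_inj; rewrite !valT CA.
- by move=> f g h fg; rewrite !(TC _ h); exact: Tr.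
- by move=> f; apply: val_inj; rewrite valT C1.
Qed.

End normal_convex.

(** * Sufficiency *)

Section sufficiency.
Variables (R : realType) (ast tri : I01 R -> I01 R -> I01 R).
Hypotheses (tast : is_tnorm ast) (ttri : is_tnorm tri).
Hypotheses (dast : divisible_op ast) (btri : border_lsc tri).
Implicit Types (f g h : M R) (a b c u v x y z : I01 R).

Local Notation C := (conv ast tri).

(** By monotonicity, a solution outside the range of [a] and [b] can be moved to an endpoint. *)
Lemma divisible_between a b z x : ast a z <= x -> x <= ast b z ->
  exists y, [/\ Order.min a b <= y, y <= Order.max a b & ast y z = x].
Proof.
move=> ax xb; have [y yx] := dast (le_trans xb (tnorm_ler tast _ _)).
have [ya|ay] := leP y a.
  exists a; rewrite ge_min le_max !lexx; split=> //.
  by apply/le_anti; rewrite ax -yx tnorm_le2.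
have [yb|by_] := leP y b.
  by exists y; rewrite ge_min le_max yb (ltW ay) orbT.
exists b; rewrite ge_min le_max !lexx !orbT; split=> //.
by apply/le_anti; rewrite xb -yx tnorm_le2 // ltW.
Qed.

(* Follow the path from [(a, c)] to [(b, d)] through the corner [(b, c)]. *)
Lemma divisible_path a b c d x : ast a c <= x -> x <= ast b d ->
  exists y z, [/\ Order.min a b <= y, y <= Order.max a b,
    Order.min c d <= z, z <= Order.max c d & ast y z = x].
Proof.
move=> acx xbd; have [xbc|/ltW bcx] := leP x (ast b c).
  have [y [ay yb <-]] := divisible_between acx xbc.
  by exists y, c; rewrite ay yb ge_min le_max lexx.
rewrite (tnormC tast) in bcx; rewrite (tnormC tast) in xbd.
have [z [cz zd <-]] := divisible_between bcx xbd.
by exists b, z; rewrite cz zd ge_min le_max lexx !orbT (tnormC tast).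
Qed.

(** Normality provides values close to 1 only, so both arguments are first lowered below [\top];
    almost-modes then dominate them. *)
Lemma border_lsc_gt a b u : u < tri a b -> exists a' b',
  [/\ a' < \top, b' < \top, a' <= a, b' <= b & u < tri a' b'].
Proof.
have top c v : v < c -> exists t c',
    [/\ t < \top, c' < \top, c' <= c & v < tri t c'].
  move=> /I01_dense[w /andP[vw wc]].
  have [t t1 vt] : exists2 t, t < \top & v < tri t w.
    apply: contrapT => H; move: vw; rewrite ltNge => /negP; apply.
    apply: btri => t t1; rewrite leNgt; apply/negP => vt; apply: H.
    by exists t.
  by exists t, w; rewrite (lt_le_trans wc (lex1 _)) ltW.
have [->|a1] := eqVneq a \top.
  rewrite (tnorm1x ttri) => /top[t [c [t1 c1 cb utc]]].
  by exists t, c; rewrite lex1.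
have [->|b1] := eqVneq b \top.
  rewrite (tnormx1 ttri) => /top[t [c [t1 c1 cb utc]]].
  by exists c, t; rewrite lex1 (tnormC ttri).
by exists a, b; rewrite !ltx1.
Qed.

Lemma conv_normal f g : is_normal f -> is_normal g -> is_normal (C f g).
Proof.
move=> nf ng; apply: normalP => u; rewrite -(tnorm1x ttri \top).
move=> /border_lsc_gt[a [b [a1 b1 _ _ uab]]].
have [[p fp] [q gq]] := (normal_gt nf a1, normal_gt ng b1).
exists (ast p q); apply: lt_le_trans (conv_ub _ _ _ _ _ _).
by apply: lt_le_trans uab _; apply: tnorm_le2 => //; exact: ltW.
Qed.

(* Given [y1 * z1 <= x <= y3 * z3], join both points by paths to an
   almost-mode [(p, q)]; the path through the level [x] does not go below the
   value at its own endpoint. *)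
Lemma conv_convex f g : in_L f -> in_L g -> is_convex (C f g).
Proof.
move=> [nf cf] [ng cg] x1 x x3 x1x xx3; rewrite leNgt; apply/negP.
rewrite lt_min => /andP[].
move=> /lt_sup01[_ [y1 [z1 [e1 <-]]]] /border_lsc_gt[a1 [b1 [a1t b1t a1f b1g ab1]]].
move=> /lt_sup01[_ [y3 [z3 [e3 <-]]]] /border_lsc_gt[a3 [b3 [a3t b3t a3f b3g ab3]]].
have : Order.max a1 a3 < \top by rewrite gt_max a1t.
move=> /(normal_gt nf)[p]; rewrite gt_max => /andP[/ltW a1p /ltW a3p].
have : Order.max b1 b3 < \top by rewrite gt_max b1t.
move=> /(normal_gt ng)[q]; rewrite gt_max => /andP[/ltW b1q /ltW b3q].
rewrite -e1 in x1x; rewrite -e3 in xx3.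
have [xpq|/ltW pqx] := leP x (ast p q).
  have [y [z [y_ge y_le z_ge z_le yz]]] := divisible_path x1x xpq.
  move: ab1; rewrite ltNge => /negP; apply.
  rewrite -yz; apply: le_trans (conv_ub _ _ _ _ _ _); apply: tnorm_le2 => //.
    by apply: le_trans (convex_between cf y_ge y_le); rewrite le_min a1f.
  by apply: le_trans (convex_between cg z_ge z_le); rewrite le_min b1g.
have [y [z [y_ge y_le z_ge z_le yz]]] := divisible_path pqx xx3.
move: ab3; rewrite ltNge => /negP; apply.
rewrite -yz; apply: le_trans (conv_ub _ _ _ _ _ _); apply: tnorm_le2 => //.
  by apply: le_trans (convex_between cf y_ge y_le); rewrite le_min a3f a3p.
by apply: le_trans (convex_between cg z_ge z_le); rewrite le_min b3g b3q.
Qed.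

Lemma conv_in_L f g : in_L f -> in_L g -> in_L (C f g).
Proof.
by move=> fL gL; split; [case: fL gL => ? _ [? _]; exact: conv_normal
  | exact: conv_convex].
Qed.

(** * Commutativity, unit and monotonicity of the convolution *)

Lemma convC f g : C f g = C g f.
Proof.
by apply/funext => x; congr sup01; apply/seteqP; split=> _ [y [z [<- <-]]];
  exists z, y; rewrite (tnormC tast) (tnormC ttri).
Qed.

Lemma conv_char_top f : C f (char01 \top) = f.
Proof.
apply/funext => x; apply/le_anti/andP; split.
  apply/ge_conv => y z; rewrite /char01; case: eqVneq => [->|_].
    by rewrite (tnormx1 tast) (tnormx1 ttri) => ->.
  by rewrite (tnormx0 ttri) le0x.
have := conv_ub ast tri f (char01 \top) x \top.
by rewrite /char01 eqxx (tnormx1 tast) (tnormx1 ttri).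
Qed.

(** By [rsup_cases] the supremum is [f x] or 1; the latter case is [border_lsc]. *)
Lemma tri_rsup f x b u : in_L f -> (forall y, x <= y -> tri (f y) b <= u) ->
  tri (rsup f x) b <= u.
Proof.
move=> fL H; have [r1|->] := rsup_cases x fL; last exact: H.
rewrite r1 (tnorm1x ttri); apply: btri => t; rewrite -r1.
move=> /lt_sup01[_ [y xy <-] /ltW ty]; apply: le_trans (H _ xy).
exact: tnorm_le2.
Qed.

Lemma tri_lsup f x b u : in_L f -> (forall y, y <= x -> tri (f y) b <= u) ->
  tri (lsup f x) b <= u.
Proof.
move=> fL H; have [r1|->] := lsup_cases x fL; last exact: H.
rewrite r1 (tnorm1x ttri); apply: btri => t; rewrite -r1.
move=> /lt_sup01[_ [y xy <-] /ltW ty]; apply: le_trans (H _ xy).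
exact: tnorm_le2.
Qed.

Lemma conv_sqle f g h : in_L f -> in_L g -> in_L h ->
  sqle g h -> sqle (C f g) (C f h).
Proof.
move=> fL gL hL; rewrite !(convC f) !sqleP //; try exact: conv_in_L.
move=> [gh hg]; split=> x; apply/ge_conv => y z yz.
  apply: le_trans (tnorm_le2 ttri (gh y) (lexx _)) _.
  apply: tri_rsup => // y' yy'; apply: le_trans (conv_ub ast tri h f y' z) _.
  by rewrite rsup_ub // -yz tnorm_le2.
apply: le_trans (tnorm_le2 ttri (hg y) (lexx _)) _.
apply: tri_lsup => // y' yy'; apply: le_trans (conv_ub ast tri g f y' z) _.
by rewrite lsup_ub // -yz tnorm_le2.
Qed.

(** [tri r] commutes with the supremum defining [C f g w]: this is the inequality that monotonicity
    does not give, and associativity rests on it. *)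
Definition distributes_conv := forall f g w r u, in_L f -> in_L g ->
  (forall b c, ast b c = w -> tri r (tri (f b) (g c)) <= u) ->
  tri r (C f g w) <= u.

Lemma left_lsc_distributes : left_lsc tri -> distributes_conv.
Proof.
move=> ltri f g w r u _ _ H; rewrite (tnormC ttri); apply: ltri => t.
move=> /lt_sup01[_ [b [c [bc <-]]] /ltW tbc]; apply: le_trans (H _ _ bc).
by rewrite (tnormC ttri); exact: tnorm_le2.
Qed.

(** The level set [min b c = w] consists of two half-lines, [b = w <= c] and [c = w <= b], so [tri]
    has to be exchanged with right suprema only. *)
Lemma min_distributes : ast = Order.min -> distributes_conv.
Proof.
move=> astE f g w r u fL gL H.
have CE : C f g w <= Order.max (tri (f w) (rsup g w)) (tri (rsup f w) (g w)).
  apply/ge_conv => b c; rewrite astE le_max; case: (leP b c) => [bc <-|/ltW cb <-].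
    by rewrite tnorm_le2 ?rsup_ub.
  by rewrite [X in _ || X]tnorm_le2 ?rsup_ub ?orbT.
apply: le_trans (tnorm_le2 ttri (lexx r) CE) _.
case: (leP (tri (f w) (rsup g w)) _) => _.
  rewrite (tnormC ttri) -(tnormA ttri); apply: tri_rsup => // b wb.
  by rewrite (tnormA ttri) (tnormC ttri); apply: H; rewrite astE min_r.
rewrite (tnormA ttri) (tnormC ttri); apply: tri_rsup => // c wc.
by rewrite (tnormC ttri) -(tnormA ttri); apply: H; rewrite astE min_l.
Qed.

Lemma convA f g h : distributes_conv -> in_L f -> in_L g -> in_L h ->
  C f (C g h) = C (C f g) h.
Proof.
move=> dC fL gL hL.
(* A nested convolution has the same upper bounds as its triple products, and these agree for both
   bracketings. *)
have ge_conv3 (k l m : M R) x u : in_L l -> in_L m -> C k (C l m) x <= u <->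
    forall a b c, ast a (ast b c) = x -> tri (k a) (tri (l b) (m c)) <= u.
  move=> lL mL; split=> [H a b c abc|H].
    apply: le_trans H; rewrite -abc; apply: le_trans (conv_ub _ _ _ _ _ _).
    by apply: tnorm_le2 => //; exact: conv_ub.
  by apply/ge_conv => a w aw; apply: dC => // b c bc; apply: H; rewrite bc.
rewrite (convC (C f g)); apply/funext => x; apply/le_anti/andP; split.
  apply/ge_conv3 => // a b c abc.
  rewrite (tnormA ttri) (tnormC ttri).
  by apply: ((ge_conv3 h f g x _ fL gL).1 (lexx _) c a b);
    rewrite (tnormC tast) -(tnormA tast).
apply/ge_conv3 => // c a b cab; rewrite (tnormC ttri) -(tnormA ttri).
by apply: ((ge_conv3 f g h x _ gL hL).1 (lexx _) a b c);
  rewrite (tnormA tast) (tnormC tast).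
Qed.

Lemma distributes_conv_tnorm : distributes_conv -> conv_tnorm_on_L ast tri.
Proof.
move=> dC; apply/conv_tnorm_on_LP; split=> *.
- exact: conv_in_L.
- exact: convA.
- exact: convC.
- exact: conv_sqle.
- exact: conv_char_top.
Qed.

End sufficiency.

Lemma left_lsc_border_lsc (R : realType) (T : I01 R -> I01 R -> I01 R) :
  is_tnorm T -> left_lsc T -> border_lsc T.
Proof. by move=> tT lT b u /lT; rewrite tnorm1x. Qed.

(** * Necessity *)

Section corner.
Variables (R : realType) (T : I01 R -> I01 R -> I01 R).
Hypothesis tT : is_tnorm T.
Implicit Types c v w x y z : I01 R.

Lemma tnorm_idempotent_min : (forall c, c <= T c c) -> T = Order.min.
Proof.
move=> idT; apply/funext => x; apply/funext => y.
apply/le_anti; rewrite le_min tnorm_lel // tnorm_ler //=.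
case: (leP x y) => [xy|/ltW yx].
  by apply: le_trans (idT x) _; exact: tnorm_le2.
by apply: le_trans (idT y) _; exact: tnorm_le2.
Qed.

(* The level set of [x] has an isolated corner at [(y, c)]: it leaves the
   vertical line through [y] only on the right of it and below [c]. A failure
   makes [x] absorb some [w] with [T w c < c]; the least [e] with [T e x = x]
   is then an idempotent, which lies neither below nor above [c]. *)
Lemma divisible_corner c : divisible_op T -> T c c < c -> exists x y,
  [/\ \bot < x, y < \top, forall y', y < y' -> x < T y' c
    & forall y' z, y' <= y -> z < c -> T y' z <> x].
Proof.
move=> dT /I01_dense[x /andP[ccx xc]].
pose y := sup01 [set y' | T y' c <= x].
have yP y' : y < y' -> x < T y' c.
  by rewrite !ltNge; apply: contra => ?; exact: sup01_ub.
have ycx : T y c = x.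
  apply/le_anti/andP; split.
    rewrite leNgt; apply/negP => /(divisible_gt tT dT)[y' + xy'].
    move=> /lt_sup01[y'' /= y''c /ltW y'y'']; move: xy'; rewrite ltNge.
    by rewrite (le_trans _ y''c) // tnorm_le2.
  have [d dc] := dT _ _ (ltW xc); rewrite -{1}dc tnorm_le2 //.
  by apply: sup01_ub; rewrite /= dc.
exists x, y; split=> //; first by rewrite (le_lt_trans _ ccx) ?le0x.
  rewrite ltx1; apply: contraTneq xc => y1.
  by rewrite -ycx y1 tnorm1x // ltxx.
(* By monotonicity, [T y' z = x] with [y' <= y] and [z < c] forces [T y z = x]. *)
suff key z : T y z = x -> c <= z.
  move=> y' z y'y zc y'z; move: (zc); rewrite ltNge => /negP; apply.
  apply/key/le_anti/andP; split; last by rewrite -{1}y'z tnorm_le2.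
  by rewrite -[leRHS]ycx tnorm_le2 // ltW.
move=> yz; rewrite leNgt; apply/negP => zc.
have [w wc] := dT _ _ (ltW zc).
have wx : T w x = x by rewrite -{1}ycx (tnormC tT y) tnormA // wc tnormC.
pose e := sup01 [set v | T v x < x].
have ex : T e x = x.
  apply/le_anti; rewrite tnorm_ler //= leNgt; apply/negP.
  move=> /(divisible_lt tT dT)[v [[|->]]]; last by rewrite tnorm1x // ltxx.
  by rewrite ltNge => /negP ev vx; apply: ev; exact: sup01_ub.
have e_min v : T v x = x -> e <= v.
  move=> vx; rewrite leNgt; apply/negP => /lt_sup01[v' /= + /ltW vv'].
  by rewrite ltNge -{1}vx tnorm_le2.
have ee : T e e = e.
  by apply/le_anti; rewrite tnorm_lel // e_min // -tnormA // ex.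
have xe : x <= e by rewrite -ex tnorm_lel.
(* [e <= c] would give [e = T e e <= T c c < x <= e]. *)
have [ec|/ltW ce] := leP e c.
  have := le_lt_trans (tnorm_le2 tT ec ec) ccx.
  by rewrite ee ltNge xe.
(* As a multiple of the idempotent [e], [c] is fixed by [e], so [c = T c e <= T c w = z]. *)
have [v vec] := dT _ _ ce.
have cec : T c e = c by rewrite -vec -tnormA // ee.
move: zc; rewrite -wc tnormC // ltNge => /negP; apply.
by rewrite -{1}cec tnorm_le2 // e_min.
Qed.

End corner.

(** * Conditions forced on [ast] and [tri] *)

Section necessity.
Variables (R : realType) (ast tri : I01 R -> I01 R -> I01 R).
Implicit Types (f g h : M R) (a b c u v x y z : I01 R).
Local Notation C := (conv ast tri).
Hypothesis LT : conv_tnorm_on_L ast tri.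

Let CL f g : in_L f -> in_L g -> in_L (C f g).
Proof. by case/conv_tnorm_on_LP: LT f g. Qed.

Let CA f g h : in_L f -> in_L g -> in_L h -> C f (C g h) = C (C f g) h.
Proof. by case/conv_tnorm_on_LP: LT f g h. Qed.

Let CC f g : in_L f -> in_L g -> C f g = C g f.
Proof. by case/conv_tnorm_on_LP: LT f g. Qed.

Let CM f g h : in_L f -> in_L g -> in_L h -> sqle g h -> sqle (C f g) (C f h).
Proof. by case/conv_tnorm_on_LP: LT f g h. Qed.

Let C1 f : in_L f -> C f (char01 \top) = f.
Proof. by case/conv_tnorm_on_LP: LT f. Qed.

Lemma char01_id a : char01 a a = \top.
Proof. by rewrite /char01 eqxx. Qed.

Lemma char01_neq a x : x != a -> char01 a x = \bot.
Proof. by rewrite /char01 => /negbTE ->. Qed.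

Lemma exists_other x y : exists a, x != a /\ y != a.
Proof.
have bt : (\bot : I01 R) != \top by rewrite lt_eqF ?bot_lt_top.
have [m /andP[m0 m1]] := I01_dense (bot_lt_top R).
have [->|x0] := eqVneq x \bot.
  have [->|y1] := eqVneq y \top; last by exists \top.
  by exists m; rewrite lt_eqF // gt_eqF.
have [->|y0] := eqVneq y \bot; last by exists \bot.
have [->|x1] := eqVneq x \top; last by exists \top.
by exists m; rewrite gt_eqF // lt_eqF.
Qed.

(** Whatever [ast \top \top] is, [char01 a] vanishes there, and the unit law bounds the product by
    this value. *)
Lemma tri_bot_top : tri \bot \top = \bot.
Proof.
have [a [ta tta]] := exists_other \top (ast \top \top).
have := conv_ub ast tri (char01 a) (char01 \top) \top \top.
have aL := char01_in_L a.
by rewrite C1 // char01_id !char01_neq // lex0 => /eqP.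
Qed.

Lemma tri_top_bot : tri \top \bot = \bot.
Proof.
have [a [ta tta]] := exists_other \top (ast \top \top).
have := conv_ub ast tri (char01 \top) (char01 a) \top \top.
have tL := char01_in_L (\top : I01 R); have aL := char01_in_L a.
by rewrite CC // C1 // char01_id !char01_neq // lex0 => /eqP.
Qed.

Lemma tri_bot_bot : tri \bot \bot = \bot.
Proof.
have [a [ta tta]] := exists_other \bot (ast \bot \bot).
have := conv_ub ast tri (char01 a) (char01 \top) \bot \bot.
have aL := char01_in_L a.
have bt : (\bot : I01 R) != \top by rewrite lt_eqF ?bot_lt_top.
by rewrite C1 // !char01_neq // lex0 => /eqP.
Qed.

Lemma tri_char a b y z : tri (char01 a y) (char01 b z) =
  if (y == a) && (z == b) then tri \top \top else \bot.
Proof.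
rewrite /char01; case: eqVneq => _; case: eqVneq => _ //=.
- exact: tri_top_bot.
- exact: tri_bot_top.
- exact: tri_bot_bot.
Qed.

(** By [tri_char], only the pair [(a, \top)] can contribute a nonzero term to
    [C (char01 a) (char01 \top)], which is 1 at [a]. *)
Lemma ast_tri_top a : ast a \top = a /\ tri \top \top = \top.
Proof.
have aC : C (char01 a) (char01 \top) a = \top.
  by rewrite C1 ?char01_id //; exact: char01_in_L.
have : \bot < C (char01 a) (char01 \top) a by rewrite aC bot_lt_top.
move=> /lt_sup01[_ [y [z [yz <-]]]]; rewrite tri_char.
case: andP => [[/eqP ya /eqP z1] _|_]; last by rewrite ltxx.
split; first by rewrite -{1}ya -z1.
apply/eqP; rewrite -le1x -[leLHS]aC; apply/ge_conv => y' z' _.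
by rewrite tri_char; case: ifP; rewrite ?lexx ?le0x.
Qed.

Lemma conv_char a b : C (char01 a) (char01 b) = char01 (ast a b).
Proof.
have [_ tri11] := ast_tri_top a.
apply/funext => x; apply/le_anti/andP; split.
  apply/ge_conv => y z <-; rewrite tri_char.
  by case: andP => [[/eqP-> /eqP->]|_]; rewrite ?char01_id ?lex1 ?le0x.
rewrite {1}/char01; case: eqVneq => [->|_]; last exact: le0x.
by have := conv_ub ast tri (char01 a) (char01 b) a b; rewrite !char01_id tri11.
Qed.

Lemma char01_inj : injective (@char01 R).
Proof.
move=> a b ab; have := char01_id a; rewrite {1}ab /char01.
by case: eqVneq => // _ /eqP; rewrite lt_eqF ?bot_lt_top.
Qed.

Lemma ast_tnorm : is_tnorm ast.
Proof.
have chL := @char01_in_L R.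
have astC : commutative ast.
  by move=> x y; apply: char01_inj; rewrite -!conv_char CC.
have ast_le x y z : y <= z -> ast x y <= ast x z.
  by move=> /sqle_char yz; apply/sqle_char; rewrite -!conv_char; exact: CM.
split=> //.
- by move=> x y z; apply: char01_inj; rewrite -!conv_char CA.
- by move=> x y z xy; rewrite !(astC _ z); exact: ast_le.
- by move=> x; have [] := ast_tri_top x.
Qed.

(** The constant 1 convolved with [char01 z] is the indicator of the values [ast y z]; it is 1 at
    [\bot] and at [z], hence by convexity at every [x <= z]. *)
Lemma ast_divisible : divisible_op ast.
Proof.
move=> x z xz; have tast := ast_tnorm; have [_ tri11] := ast_tri_top z.
pose f : M R := fun=> \top; have fL : in_L f by exact: isotone_in_L.
have [_ /(_ \bot x z)] := CL fL (char01_in_L z).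
rewrite le0x => /(_ isT xz); have at_z y : \top <= C f (char01 z) (ast y z).
  have := conv_ub ast tri f (char01 z) y z.
  by rewrite char01_id tri11.
have := at_z \bot; have := at_z \top.
rewrite tnorm0x // tnorm1x // !le1x => /eqP -> /eqP ->.
rewrite minxx => Cx; have := lt_le_trans (bot_lt_top R) Cx.
move=> /lt_sup01[_ [y [z' [yz' <-]]]]; rewrite /f.
have -> : (\top : I01 R) = char01 \top \top by rewrite char01_id.
rewrite tri_char eqxx /=; case: eqVneq yz' => [-> yz|_ _]; last by rewrite ltxx.
by exists y.
Qed.

(** The value at [\bot] ensures normality and leaves [b] free everywhere else. *)
Definition step b : M R := fun x => if x == \bot then \top else b.

Lemma step_bot b : step b \bot = \top.
Proof. by rewrite /step eqxx. Qed.

Lemma step_gt b x : \bot < x -> step b x = b.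
Proof. by rewrite /step; case: eqVneq => // ->; rewrite ltxx. Qed.

Lemma step_in_L b : in_L (step b).
Proof.
apply: antitone_in_L => [|x y xy]; first exact: step_bot.
rewrite /step; case: (eqVneq x) => [|x0]; first by rewrite lex1.
by rewrite gt_eqF // (lt_le_trans _ xy) // lt0x.
Qed.

(** A t-norm reaches [\top] only at [(\top, \top)], so the supremum has a single term; the laws of
    [tri] are read off here. *)
Lemma conv_top f g : C f g \top = tri (f \top) (g \top).
Proof.
apply/le_anti/andP; split.
  by apply/ge_conv => y z /(tnorm_top ast_tnorm)[-> ->].
by have := conv_ub ast tri f g \top \top; rewrite (tnorm1x ast_tnorm).
Qed.

Lemma tri_tnorm : is_tnorm tri.
Proof.
have stT b : step b \top = b by rewrite step_gt ?bot_lt_top.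
have triE a b : tri a b = C (step a) (step b) \top by rewrite conv_top !stT.
have stL := step_in_L.
have triC : commutative tri by move=> x y; rewrite !triE CC.
have tri_le x y z : y <= z -> tri x y <= tri x z.
  move=> yz; have le_st t : step y t <= step z t by rewrite /step; case: ifP.
  have /CM : sqle (step y) (step z).
    apply/sqleP => //; split=> t; first exact: le_trans (le_st t) (rsup_ub _ _).
    by apply: le_trans (lsup_ub _ (le0x t)); rewrite step_bot lex1.
  move=> /(_ (step x) (stL x) (stL y) (stL z)).
  move=> /(sqleP (CL (stL x) (stL y)) (CL (stL x) (stL z)))[/(_ \top) + _].
  (* Only [\top] lies above [\top], so [rsup] there is the plain value. *)
  rewrite triE => /le_trans; apply; apply/ge_sup01 => _ [t /= t1 <-].
  by move: t1; rewrite le1x => /eqP ->; rewrite triE.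
split=> //.
- move=> x y z; rewrite -[x in LHS]stT -[y in LHS]stT -[z in LHS]stT.
  by rewrite -!conv_top CA // !conv_top !stT.
- by move=> x y z xy; rewrite !(triC _ z); exact: tri_le.
- move=> x; rewrite -{1}[x]stT -[X in tri _ X](char01_id \top) -conv_top.
  by rewrite C1.
Qed.

(* The characteristic function [k] of [m] lies below [g], whose supremum is not
   attained; comparing [step b * k] with [step b * g] at [m] gives the bound. *)
Lemma tri_border_lsc : border_lsc tri.
Proof.
move=> b u Hu; have [tast ttri] := (ast_tnorm, tri_tnorm).
have [m /andP[m0 m1]] := I01_dense (bot_lt_top R).
have [r [r_anti r_lt r_sup]] := exists_ramp m1 (bot_lt_top R).
(* [g] climbs to 1 as its argument decreases to [m], but is [\bot] at [m] itself. *)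
pose g : M R := fun x => if x <= m then \bot else r x.
have g_gt x : m < x -> g x = r x by rewrite /g => mx; rewrite leNgt mx.
have g_lt x : g x < \top.
  by rewrite /g; case: (leP x m) => [_|/r_lt]; rewrite ?bot_lt_top.
have gL : in_L g.
  split; first by apply: normalP => v /r_sup[x mx vx]; exists x; rewrite g_gt.
  move=> x y z xy yz; rewrite {1}/g; case: (leP x m) => [_|mx].
    by rewrite ge_min le0x.
  have my := lt_le_trans mx xy; have mz := lt_le_trans my yz.
  by rewrite !g_gt // ge_min [X in _ || X]r_anti ?orbT.
have kL := char01_in_L m; have bL := step_in_L b.
have kg : sqle (char01 m) g.
  apply/sqleP => //; split=> x; last first.
    rewrite /g; case: (leP x m) => [_|/ltW mx]; first exact: le0x.
    by apply: le_trans (lsup_ub _ mx); rewrite char01_id lex1.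
  rewrite /char01; case: eqVneq => [->|_]; last exact: le0x.
  rewrite leNgt; apply/negP => /r_sup[y my].
  by rewrite -g_gt // ltNge rsup_ub // ltW.
have := CM bL kL gL kg.
move=> /(sqleP (CL bL kL) (CL bL gL))[/(_ m) H _].
have := conv_ub ast tri (step b) (char01 m) \top m.
rewrite tnorm1x // char01_id tnormx1 // step_gt ?bot_lt_top // => /le_trans; apply.
apply: le_trans H _; apply/ge_sup01 => _ [x /= mx <-].
(* Since [y >= x >= m > \bot], every term is [tri b (g z)] with [g z < \top]. *)
apply/ge_conv => y z yz; rewrite step_gt.
  by rewrite tnormC //; exact: Hu.
by rewrite (lt_le_trans m0) // (le_trans mx) // -yz tnorm_lel.
Qed.

(* Near the corner [(y0, c)] of the level [x], [f * g] takes at [x] the value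
   [a] as an unattained supremum, so that associativity of [f * g * step b] at
   [x] exchanges this supremum with [tri _ b]. *)
Lemma tri_left_lsc : ast <> Order.min -> left_lsc tri.
Proof.
have [tast ttri] := (ast_tnorm, tri_tnorm).
move=> ast_min a b u Hu.
have [a0|a_gt0] := leP a \bot.
  by move: a0; rewrite lex0 => /eqP ->; rewrite tnorm0x ?le0x.
have [c ccc] : exists c, ast c c < c.
  apply: contrapT => H; apply/ast_min/tnorm_idempotent_min => // c.
  by rewrite leNgt; apply/negP => cc; apply: H; exists c.
have [x [y0 [x_gt0 y0_1 y0_lt corner]]] := divisible_corner tast ast_divisible ccc.
have [r [r_anti r_lt r_sup]] := exists_ramp y0_1 a_gt0.
pose f : M R := fun y => if y <= y0 then \top else r y.
have f_gt y : y0 < y -> f y = r y by rewrite /f => mx; rewrite leNgt mx.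
have fL : in_L f.
  apply: antitone_in_L => [|y y' yy']; first by rewrite /f le0x.
  rewrite {2}/f; case: (leP y y0) => [_|y0y]; first exact: lex1.
  by rewrite f_gt ?r_anti // (lt_le_trans y0y).
pose g : M R := fun z => if z < c then \top else \bot.
have gL : in_L g.
  apply: antitone_in_L => [|z z' zz'].
    by rewrite /g (le_lt_trans (le0x _) ccc).
  rewrite {1}/g; case: (ltP z' c) => [z'c|_]; last exact: le0x.
  by rewrite /g (le_lt_trans zz').
have hL := step_in_L b.
(* Every [y > y0] has a partner [z < c] on the level [x], because [ast y c > x]; the resulting terms
   [r y] have supremum [a]. *)
have a_le : a <= C f g x.
  rewrite leNgt; apply/negP => /r_sup[y y0y].
  have xy := lt_le_trans (y0_lt _ y0y) (tnorm_lel tast _ _).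
  have [z zy] := ast_divisible (ltW xy).
  have zc : z < c.
    rewrite ltNge; apply/negP => cz.
    have := lt_le_trans (y0_lt _ y0y) (tnorm_le2 tast (lexx y) cz).
    by rewrite tnormC // zy ltxx.
  have := conv_ub ast tri f g y z.
  rewrite (tnormC tast) zy f_gt // /g zc tnormx1 // => /le_lt_trans le /le.
  by rewrite ltxx.
have := conv_ub ast tri (C f g) (step b) x \top.
rewrite -CA // (tnormx1 tast) step_gt ?bot_lt_top //.
move=> /(le_trans (tnorm_le2 ttri a_le (lexx b))) /le_trans; apply.
(* After reassociation a term can be nonzero only if [w < c]; the corner then forces [y > y0], so
   its first factor is [r y < a]. *)
apply/ge_conv => y w yw.
(* This keeps the argument of [step b] off [\bot], where its value is 1 instead of [b]. *)
have w0 : \bot < w.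
  by rewrite lt0x; apply: contraTneq x_gt0 => w0; rewrite -yw w0 tnormx0 // ltxx.
have [cw|wc] := leP c w.
  have -> : C g (step b) w = \bot.
    apply/eqP; rewrite -lex0; apply/ge_conv => p q pq.
    rewrite {1}/g ltNge (le_trans cw) /= ?tnorm0x //.
    by rewrite -pq tnorm_lel.
  by rewrite tnormx0 ?le0x.
have y0y : y0 < y.
  by rewrite ltNge; apply/negP => yy0; exact: corner yy0 wc yw.
rewrite f_gt //; apply: le_trans (Hu _ (r_lt _ y0y)).
apply: tnorm_le2 => //; apply/ge_conv => p q pq.
rewrite step_gt ?tnorm_ler //.
by rewrite (lt_le_trans w0) // -pq tnorm_ler.
Qed.

End necessity.

Theorem theorem4p19 (R : realType) (ast tri : I01 R -> I01 R -> I01 R) :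
  conv_tnorm_on_L ast tri <->
  [/\ is_tnorm ast /\ continuous_op ast,
      ast <> Order.min -> is_tnorm tri /\ left_continuous_op tri
    & ast = Order.min -> is_tnorm tri /\ border_continuous_op tri].
Proof.
split=> [LT|[[tast cast] tri_neq tri_min]].
  have [tast ttri] := (ast_tnorm LT, tri_tnorm LT); split.
  - by split=> //; exact: divisible_continuous tast (ast_divisible LT).
  - move=> ast_min; split=> //; apply/(left_continuous_lscP ttri).
    exact: tri_left_lsc LT ast_min.
  - by split=> //; apply/(border_continuous_lscP ttri); exact: tri_border_lsc LT.
have dast := continuous_divisible tast cast.
have [astE|astN] := pselect (ast = Order.min).
  have [ttri /(border_continuous_lscP ttri) btri] := tri_min astE.
  by apply: distributes_conv_tnorm => //; exact: min_distributes.
have [ttri /(left_continuous_lscP ttri) ltri] := tri_neq astN.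
apply: distributes_conv_tnorm => //; first exact: left_lsc_border_lsc.
exact: left_lsc_distributes.
Qed.
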